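(* Let $\mu$ and $\nu$ be probability measures on $\mathbb{R}^d$ with densities, let $\nabla\Phi$ be the optimal transportation mapping pushing $\mu$ forward onto $\nu$, and let $M$ be $\mathbb{R}^d$ equipped with the Riemannian metric $g=D^2\Phi$ and the corresponding Riemannian distance $d_M$. Then for all $x,y\in\mathbb{R}^d$ $$d_M^2(x,y)\le\langle\nabla\Phi(y)-\nabla\Phi(x),\,y-x\rangle\le d(x,y)\cdot d(\nabla\Phi(x),\nabla\Phi(y)),$$ where $d$ is the standard Euclidean distance.
   Context: The convex potential $\Phi$ is assumed smooth on $\mathbb{R}^d$ with positive definite Hessian, so that $g_{ij}=\partial_{x_i}\partial_{x_j}\Phi$ (in standard coordinates) is a Riemannian metric on $\mathbb{R}^d$. *)

(* Defs.v *)
From HB Require Import structures.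
From mathcomp Require Import all_boot all_order all_algebra.
From mathcomp Require Import all_classical all_reals all_analysis.
From mathcomp Require Import measurable_realfun.
Import Order.TTheory GRing.Theory Num.Theory.
Import numFieldNormedType.Exports.

Set Implicit Arguments.
Unset Strict Implicit.
Unset Printing Implicit Defensive.

Local Open Scope classical_set_scope.
Local Open Scope ring_scope.

(* R^d is 'rV[R]_d. The norm that the library puts on 'rV[R]_d is the sup norm;
   it is used here only for the topology and for differentiation, and the
   Euclidean structure is given by [dot] and [euclidean_dist]. *)

Section Euclidean.
Context {R : realType} {d : nat}.
Implicit Types x y : 'rV[R]_d.

Definition dot x y : R := \sum_(i < d) x 0 i * y 0 i.

Definition euclidean_dist x y : R := Num.sqrt (dot (y - x) (y - x)).

End Euclidean.

Section Calculus.
Context {R : realType} {d : nat}.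
Implicit Types f : 'rV[R]_d -> R.

Definition partial (i : 'I_d) f : 'rV[R]_d -> R :=
  fun x => 'D_(delta_mx 0 i) f x.

Definition partials (s : seq 'I_d) f : 'rV[R]_d -> R := foldr partial f s.

(* C^oo: the partial derivatives of all orders exist and are continuous *)
Definition smooth f :=
  forall s : seq 'I_d, continuous (partials s f) /\
    forall (i : 'I_d) x, derivable (partials s f) x (delta_mx 0 i).

Definition gradient f (x : 'rV[R]_d) : 'rV[R]_d := \row_i partial i f x.

Definition hessian f (x : 'rV[R]_d) : 'M[R]_d :=
  \matrix_(i, j) partial i (partial j f) x.

Definition posdefmx (A : 'M[R]_d) :=
  A^T = A /\ forall v : 'rV[R]_d, v != 0 -> 0 < (v *m A *m v^T) 0 0.

End Calculus.

Section RiemannianDistance.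
Context {R : realType} {d : nat}.
(* [g x] is the matrix of the metric at [x] in the standard coordinates *)
Variable g : 'rV[R]_d -> 'M[R]_d.
Implicit Types c h : R -> 'rV[R]_d.

Definition tangent_norm (x v : 'rV[R]_d) : R :=
  Num.sqrt ((v *m g x *m v^T) 0 0).

Definition C1_curve h := (forall t, derivable h t 1) /\ continuous (derive1 h).

(* Curves are parametrized by [0, 1]; their values outside are irrelevant.
   On each of finitely many closed pieces [c] coincides with a C^1 curve, so
   [c] is continuous on [0, 1] and its derivative, taken in the library's
   two-sided sense, is the intended one off the finitely many breakpoints,
   which the integral in [curve_length] does not see. *)
Definition piecewise_C1 c :=
  exists (n : nat) (s : nat -> R),
    [/\ s 0%N = 0, s n = 1 &
      forall i, (i < n)%N -> s i < s i.+1 /\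
        exists2 h, C1_curve h & {in `[s i, s i.+1], c =1 h}].

Definition curve_length c : \bar R :=
  \int[lebesgue_measure]_(t in `[0, 1]) (tangent_norm (c t) (derive1 c t))%:E.

Definition riemannian_dist (x y : 'rV[R]_d) : \bar R :=
  ereal_inf [set curve_length c
            | c in [set c | [/\ piecewise_C1 c, c 0 = x & c 1 = y]]].

End RiemannianDistance.

Notation borel_rV R d := (g_sigma_algebraType (@open ('rV[R]_d))).

Section LebesgueMeasure.
Context {R : realType}.

Definition cons_rV d (p : R * 'rV[R]_d) : 'rV[R]_d.+1 :=
  row_mx (p.1%:M : 'rV[R]_1) p.2.

Lemma cons_rV0 d (p : R * 'rV[R]_d) : cons_rV p 0 0 = p.1.
Proof.
rewrite (_ : 0 = lshift d (0 : 'I_1)); last exact/val_inj.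
by rewrite /cons_rV (row_mxEl (p.1%:M : 'rV_1) p.2) mxE eqxx.
Qed.

Lemma cons_rVS d (p : R * 'rV[R]_d) i : cons_rV p 0 (rshift 1 i) = p.2 0 i.
Proof. by rewrite /cons_rV (row_mxEr (p.1%:M : 'rV_1) p.2). Qed.

Lemma cons_rVK d (v : 'rV[R]_d.+1) :
  cons_rV (v 0 0, \row_i v 0 (rshift 1 i)) = v.
Proof.
apply/rowP => i; case: (@split_ordP 1 d i) => j ->.
  rewrite ord1 (_ : lshift d 0 = 0); last exact/val_inj.
  by rewrite cons_rV0.
by rewrite cons_rVS mxE.
Qed.

Lemma cons_rV_inj d : injective (@cons_rV d).
Proof.
move=> [a u] [b v] e; have := congr1 (fun w : 'rV_d.+1 => w 0 0) e.
rewrite !cons_rV0 /= => ->; congr (_, _); apply/rowP => i.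
by have := congr1 (fun w : 'rV_d.+1 => w 0 (rshift 1 i)) e; rewrite !cons_rVS.
Qed.

Lemma rat_approx (x e : R) : 0 < e -> exists q : rat, ball (ratr q : R) e x.
Proof.
move=> e0; have /rat_in_itvoo[q] : x - e < x + e.
  by rewrite ltrD2l gtrN.
rewrite in_itv/= => /andP[q1 q2]; exists q.
by rewrite /ball/= ltr_distl q1.
Qed.

Lemma measurable_cons_rV d :
  measurable_fun setT (@cons_rV d : R * borel_rV R d -> borel_rV R d.+1).
Proof.
apply: (@measurability _ _ (R * borel_rV R d)%type (borel_rV R d.+1) setT
  (@cons_rV d) (@open 'rV[R]_d.+1) erefl) => _ [A oA <-]; rewrite setTI.
pose U (k : rat * 'rV[rat]_d * nat) : set (R * borel_rV R d) :=
  ball (ratr k.1.1 : R) (k.2.+1%:R^-1) `*`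
  ball (\row_j (ratr (k.1.2 0 j) : R)) (k.2.+1%:R^-1).
have mU k : measurable (U k).
  apply: measurableX; first exact: measurable_ball.
  by apply: sub_sigma_algebra; apply: ball_open.
rewrite (_ : _ @^-1` A = \bigcup_(k in [set k | U k `<=` @cons_rV d @^-1` A]) U k).
  rewrite bigcup_mkcond; apply: countable_bigcupT_measurable => // k.
  by case: ifP.
apply/seteqP; split=> [p /= Ap|p [k /= + Ukp]]; last by apply.
have [e /= e0 eA] : exists2 e : R, 0 < e & ball (cons_rV p) e `<=` A.
  by have /nbhs_ballP[e /= e0 eA] := open_nbhs_nbhs (conj oA Ap); exists e.
have [m me] : exists m : nat, m.+1%:R^-1 < e / 2.
  have := near_infty_natSinv_lt (PosNum (divr_gt0 e0 (ltr0n R 2))).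
  by move=> [N _ /(_ N (leqnn N))]; exists N.
have m0 : 0 < m.+1%:R^-1 :> R by rewrite invr_gt0.
have [q qp] := rat_approx p.1 m0.
have [r rp] : exists r : 'rV[rat]_d,
    forall j, ball (ratr (r 0 j) : R) (m.+1%:R^-1) (p.2 0 j).
  have /choice[r rp] := fun j => rat_approx (p.2 0 j) m0.
  by exists (\row_j r j) => j; rewrite mxE.
exists (q, r, m) => /=.
  move=> [a u] [/= qa [_ ru]]; apply: eA.
  split=> // i j; rewrite {i}ord1; case: (@split_ordP 1 d j) => l ->.
    rewrite ord1 (_ : lshift d 0 = 0); last exact/val_inj.
    rewrite !cons_rV0 /=; apply: (@ball_split _ _ (ratr q : R)).
      exact/ball_sym/(le_ball (ltW me)).
    exact: (le_ball (ltW me)).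
  rewrite !cons_rVS /=; apply: (@ball_split _ _ (ratr (r 0 l) : R)).
    exact/ball_sym/(le_ball (ltW me)).
  by apply: (le_ball (ltW me)); have := ru 0 l; rewrite mxE.
split=> //=; split=> // i j; rewrite {i}ord1 mxE; exact: rp.
Qed.

Section cons_measure.
Variables (d : nat) (m : {sigma_finite_measure set (borel_rV R d) -> \bar R}).

Definition cons_measure : set (borel_rV R d.+1) -> \bar R :=
  pushforward (@lebesgue_measure R \x m)%E
    (@cons_rV d : R * borel_rV R d -> borel_rV R d.+1).

Let mu := [the measure _ _ of
  measure_function_pushforward__canonical__measure_function_Measure
    (@lebesgue_measure R \x m)%E (@measurable_cons_rV d)].

Let cons_measure0 : cons_measure set0 = 0%E.
Proof. exact: (measure0 mu). Qed.

Let cons_measure_ge0 A : (0 <= cons_measure A)%E.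
Proof. exact: (measure_ge0 mu). Qed.

Let cons_measure_sigma_additive : semi_sigma_additive cons_measure.
Proof. exact: (@measure_semi_sigma_additive _ _ _ mu). Qed.

HB.instance Definition _ := isMeasure.Build _ _ _ cons_measure
  cons_measure0 cons_measure_ge0 cons_measure_sigma_additive.

Let cons_measure_sigma_finite : sigma_finite setT cons_measure.
Proof.
have [F FT Ffin] : sigma_finite setT (@lebesgue_measure R \x m)%E.
  have /sigma_finiteP[F [TF ndF Foo]] := sigma_finiteT (@lebesgue_measure R).
  have /sigma_finiteP[G [TG ndG Goo]] := sigma_finiteT m.
  exists (fun n => F n `*` G n).
    rewrite -setXTT TF TG predeqE => -[x y]; split.
      move=> [/= [n _ Fnx] [k _ Gky]]; exists (maxn n k) => //; split.
      - by move: x Fnx; exact/subsetPset/ndF/leq_maxl.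
      - by move: y Gky; exact/subsetPset/ndG/leq_maxr.
    by move=> [n _ []/= Fnx Gny]; split; exists n.
  move=> k; have [? ?] := Foo k; have [? ?] := Goo k.
  split; first exact: measurableX.
  by rewrite product_measure1E// lte_mul_pinfty// ge0_fin_numE.
pose tl (v : borel_rV R d.+1) : borel_rV R d := \row_i v 0 (rshift 1 i).
have mhd : measurable_fun setT (fun v : borel_rV R d.+1 => v 0 0 : R).
  apply: (measurability _ (RGenOpens.measurableE R)) => _ [_ [a [b ->]] <-].
  rewrite setTI; apply: sub_sigma_algebra; apply: open_comp => // v _.
  exact: coord_continuous.
have mtl : measurable_fun setT tl.
  apply: (@measurability _ _ (borel_rV R d.+1) (borel_rV R d) setT
    tl (@open 'rV[R]_d) erefl) => _ [A oA <-]; rewrite setTI.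
  apply: sub_sigma_algebra; apply: (@open_comp 'rV[R]_d.+1 'rV[R]_d) => //.
  move=> v _ B /nbhs_ballP[e /= e0 eB]; apply/nbhs_ballP; exists e => //= w.
  by move=> [_ vw]; apply: eB; split=> // i j; rewrite !mxE; exact: vw.
pose ht (v : borel_rV R d.+1) : R * borel_rV R d := (v 0 0, tl v).
have mht : measurable_fun setT ht.
  exact: measurable_fun_pair.
exists (fun n => ht @^-1` F n).
  by rewrite -preimage_bigcup -FT preimage_setT.
move=> n; have [mF Foo] := Ffin n; split.
  by rewrite -[X in measurable X]setTI; exact: mht.
rewrite /cons_measure /pushforward -comp_preimage.
rewrite (_ : _ \o _ = id) ?preimage_id//.
apply/funext => p; apply: cons_rV_inj.
by rewrite /= cons_rVK.
Qed.

HB.instance Definition _ := Measure_isSigmaFinite.Build _ _ _ cons_measure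
  cons_measure_sigma_finite.

End cons_measure.

(* Lebesgue measure on the Borel sets of R^d, as the d-fold product of the
   one-dimensional one; [lebesgue_rV_box] below checks its value on boxes *)
Fixpoint lebesgue_rV d : {sigma_finite_measure set (borel_rV R d) -> \bar R} :=
  if d is d'.+1 then cons_measure (lebesgue_rV d')
  else dirac ((0 : 'rV[R]_0) : borel_rV R 0).

Definition closed_box d (a b : 'rV[R]_d) : set (borel_rV R d) :=
  [set x | forall i, a 0 i <= x 0 i <= b 0 i].

Lemma measurable_box d (a b : 'rV[R]_d) : measurable (closed_box a b).
Proof.
rewrite -(setCK (closed_box a b)); apply: measurableC; apply: sub_sigma_algebra.
apply: (@closed_openC 'rV[R]_d); rewrite (_ : closed_box a b =
    \bigcap_(i in setT) ((fun x : 'rV[R]_d => x 0 i) @^-1` `[a 0 i, b 0 i])).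
  apply: closed_bigI => i _; apply: preimage_closed; last exact: interval_closed.
  by move=> x _; exact: coord_continuous.
apply/seteqP; split=> x /= xab i; first by move=> _; rewrite /= in_itv/=.
by have /= := xab i I; rewrite in_itv.
Qed.

Lemma lebesgue_rV_box d (a b : 'rV[R]_d) : (forall i, a 0 i <= b 0 i) ->
  lebesgue_rV d (closed_box a b) = (\prod_(i < d) (b 0 i - a 0 i))%:E.
Proof.
elim: d a b => [|d IH] a b ab.
  by rewrite big_ord0 /= diracE mem_set// => -[].
have liftE (i : 'I_d) : rshift 1 i = lift 0 i :> 'I_d.+1 by apply: val_inj.
pose tl (v : 'rV[R]_d.+1) : 'rV[R]_d := \row_i v 0 (lift 0 i).
have tlE v i : tl v 0 i = v 0 (lift 0 i) by rewrite mxE.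
rewrite big_ord_recl /= /cons_measure /pushforward.
rewrite (_ : _ @^-1` _ =
    `[a 0 0, b 0 0] `*` closed_box (tl a) (tl b)); last first.
  apply/seteqP; split=> -[x u] /=.
    move=> h; split=> [|i]; first by have := h 0; rewrite cons_rV0 in_itv.
    by have := h (lift 0 i); rewrite ?tlE -liftE cons_rVS.
  move=> [h0 h] i; case: (unliftP 0 i) => [j|] ->.
    by have := h j; rewrite ?tlE -liftE cons_rVS.
  by move: h0; rewrite cons_rV0 in_itv.
rewrite product_measure1E//; last exact: measurable_box.
rewrite [X in (X * _)%E](lebesgue_measure_itv `[a 0 0, b 0 0]) /=.
rewrite IH; last by move=> i; rewrite !tlE.
rewrite EFinM; congr (_ * _)%E.
  rewrite lte_fin; case: ifPn => [_|]; first by rewrite EFinB.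
  rewrite -leNgt => ba; rewrite (_ : b 0 ord0 = a 0 ord0) ?subrr//.
  by apply/eqP; rewrite eq_le ba ab.
by congr EFin; apply: eq_bigr => i _; rewrite !tlE.
Qed.

End LebesgueMeasure.

Section Transport.
Context {R : realType} {d : nat}.
Implicit Types (mu nu : probability (borel_rV R d) R).
Implicit Types (T S : 'rV[R]_d -> 'rV[R]_d).

Definition has_density mu :=
  exists f : borel_rV R d -> R,
    [/\ measurable_fun setT f, forall x, 0 <= f x &
      forall A, measurable A ->
        mu A = (\int[lebesgue_rV d]_(x in A) (f x)%:E)%E].

Definition transport_map mu nu T :=
  measurable_fun setT (T : borel_rV R d -> borel_rV R d) /\
  forall A : set (borel_rV R d), measurable A -> mu (T @^-1` A) = nu A.

Definition transport_cost mu T : \bar R :=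
  (\int[mu]_x (euclidean_dist x (T x) ^+ 2)%:E)%E.

(* solution of Monge's problem for the quadratic cost *)
Definition optimal_transport_map mu nu T :=
  transport_map mu nu T /\
  forall S, transport_map mu nu S ->
    (transport_cost mu T <= transport_cost mu S)%E.

End Transport.

(* Main.v *)
(** The length of the straight segment [c t = t *: (y - x) + x] bounds the
    Riemannian distance. With [q t] the squared [g]-norm of its velocity, the
    Hessian matrix being the derivative of the gradient makes [q] the derivative
    of [t |-> <gradient Phi (c t), y - x>], so [\int q] over [0, 1] is
    [<gradient Phi y - gradient Phi x, y - x>], and Cauchy-Schwarz gives
    [(\int sqrt q)^2 <= \int q]. The second inequality is Cauchy-Schwarz for
    the dot product. *)

Require Import Defs.
From mathcomp Require Import all_boot all_order all_algebra.
From mathcomp Require Import all_classical all_reals all_analysis.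
From mathcomp Require Import measurable_realfun ring lra.
Import Order.TTheory GRing.Theory Num.Theory.
Import numFieldNormedType.Exports.

Set Implicit Arguments.
Unset Strict Implicit.
Unset Printing Implicit Defensive.

Local Open Scope classical_set_scope.
Local Open Scope ring_scope.

(** Derivability and the value of the derivative become one convergence, so limit lemmas apply
    directly. *)
Lemma is_deriveP (R : realType) (V W : normedModType R) (f : V -> W)
    (x v : V) (l : W) :
  is_derive x v f l <-> h^-1 *: (f (h *: v + x) - f x) @[h --> (0 : R)^'] --> l.
Proof.
split=> [[fd fl]|fl].
  by rewrite -fl; exact: fd.
apply: DeriveDef; first by apply/cvg_ex; exists l.
exact/cvg_lim.
Qed.

(** The two difference quotients agree for every [h], so a directional derivative of [f] suffices
    and no chain rule for a differentiable [f] is invoked. *)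
Lemma is_derive_line (R : realType) (V W : normedModType R) (f : V -> W)
    (x v : V) (t : R) (l : W) :
  is_derive (t *: v + x) v f l ->
  is_derive t 1 (fun s => f (s *: v + x)) l.
Proof.
move=> /is_deriveP fl; apply/is_deriveP; apply: cvg_trans fl.
apply: near_eq_cvg; near=> h.
by rewrite /= scalerDl addrA [h *: 1]mulr1.
Unshelve. all: by end_near. Qed.

(** One-variable mean value theorem for [u |-> f ((s * u) *: e + x)] on [0, 1]; scaling by [s]
    inside avoids a case distinction on its sign. *)
Lemma dir_mean_value (R : realType) (V : normedModType R) (f : V -> R)
    (e : V) (df : V -> R) :
  (forall x, is_derive x e f (df x)) ->
  forall x s, exists2 c, 0 <= c <= 1 &
    f (s *: e + x) - f x = s * df ((c * s) *: e + x).
Proof.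
move=> fd x s.
have gd (u : R) : is_derive u 1 (fun u => f ((s * u) *: e + x))
                          (s * df ((u * s) *: e + x)).
  have h1 := is_derive_line (fd ((s * u) *: e + x)).
  have h2 : is_derive u 1 (fun u : R => s * u) s.
    by apply: is_derive_eq; rewrite [s *: 1]mulr1.
  have := @is_derive1_comp R (fun r => f (r *: e + x)) ( *%R s) u _ _ h1 h2.
  by rewrite (mulrC u) (mulrC s (df _)).
have [c c01 e1] : exists2 c, c \in `[0, 1]%R &
    f ((s * 1) *: e + x) - f ((s * 0) *: e + x) =
    s * df ((c * s) *: e + x) * (1 - 0).
  apply: (@MVT_segment R (fun u => f ((s * u) *: e + x))
     (fun u => s * df ((u * s) *: e + x)) 0 1 ler01) => //.
  apply: continuous_subspaceT => u.
  apply/differentiable_continuous/derivable1_diffP.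
  by case: (gd u).
exists c; first by move: c01; rewrite in_itv.
by move: e1; rewrite mulr0 scale0r add0r mulr1 subr0 mulr1.
Qed.

(* The mean value theorem turns the extra increment
   [f (a h e + h w + x) - f (h w + x)] into [a h] times [df] at a point
   tending to [x]. *)
Lemma is_derive_dirD (R : realType) (V : normedModType R) (f : V -> R)
    (e : V) (df : V -> R) (x w : V) (l a : R) :
  (forall y, is_derive y e f (df y)) -> continuous df ->
  is_derive x w f l -> is_derive x (a *: e + w) f (a * df x + l).
Proof.
move=> fd dfc /is_deriveP fw; apply/is_deriveP.
have /choice[c cP] : forall h : R, exists c : R, 0 <= c <= 1 /\
    f ((h * a) *: e + (h *: w + x)) - f (h *: w + x) =
    h * a * df ((c * (h * a)) *: e + (h *: w + x)).
  move=> h; have [c c1 c2] := dir_mean_value fd (h *: w + x) (h * a).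
  by exists c.
have h0 : h @[h --> (0:R)^'] --> (0 : R) by exact: nbhs_dnbhs.
(* [c] comes from choice, without any regularity; [0 <= c h <= 1] alone forces this limit. *)
have c0 : c h * (h * a) @[h --> (0:R)^'] --> (0 : R).
  apply/norm_cvg0P.
  apply: (@squeeze_cvgr _ _ _ _ (cst 0) (fun h => `|h * a|)).
  - near=> h; rewrite normr_ge0/= normrM.
    have [/andP[ch0 ch1] _] := cP h.
    by rewrite ger0_norm// ler_piMl.
  - exact: cvg_cst.
  - have ha : h * a @[h --> (0:R)^'] --> (0 : R).
      by have := cvgMr_tmp (b := a) h0; rewrite mul0r => h1; exact: h1.
    have := cvg_norm ha; rewrite normr0 => h1; exact: h1.
pose p (h : R) : V := (c h * (h * a)) *: e + (h *: w + x).
have px : p h @[h --> (0:R)^'] --> x.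
  have := cvgD (cvgZr_tmp (a := e) c0) (cvgD (cvgZr_tmp (a := w) h0) (cvg_cst x)).
  by rewrite !scale0r !add0r; exact.
have dfx : df (p h) @[h --> (0:R)^'] --> df x.
  exact: (@cvg_comp _ _ _ p df _ _ _ px (dfc x)).
have qx : a * df (p h) + h^-1 *: (f (h *: w + x) - f x) @[h --> (0 : R)^'] -->
    a * df x + l.
  by apply: cvgD fw; exact: cvgMl_tmp.
apply: cvg_trans qx; apply: near_eq_cvg.
near=> h => /=.
have hn0 : h != 0 by near: h; exact: nbhs_dnbhs_neq.
have [_ ch] := cP h.
rewrite (scalerDr h) scalerA -addrA.
transitivity (h^-1 *: (f ((h * a) *: e + (h *: w + x)) - f (h *: w + x)) +
   h^-1 *: (f (h *: w + x) - f x)).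
  by congr (_ + _); rewrite ch -mulrA; exact/esym/mulKf.
by rewrite -scalerDr subrKA.
Unshelve. all: by end_near. Qed.

(** The direction [v] is assembled from multiples of basis vectors, each added by [is_derive_dirD],
    starting from direction 0, along which difference quotients vanish. *)
Lemma is_derive_partials (R : realType) (d : nat) (f : 'rV[R]_d -> R)
    (df : 'I_d -> 'rV[R]_d -> R) :
  (forall i x, is_derive x (delta_mx 0 i) f (df i x)) ->
  (forall i, continuous (df i)) ->
  forall x v, is_derive x v f (\sum_i v 0 i * df i x).
Proof.
move=> fd dfc x v; rewrite [v in is_derive _ v](row_sum_delta v).
elim: (index_enum _) => [|i s IH].
  rewrite !big_nil; apply/is_deriveP.
  under eq_fun do rewrite scaler0 add0r subrr scaler0; exact: cvg_cst.
by rewrite !big_cons; exact: is_derive_dirD.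
Qed.

(** Cauchy-Schwarz against the constant 1, obtained by integrating a pointwise AM-GM bound with a
    well-chosen parameter. *)
Lemma sqr_integral_sqrt_le (R : realType) (F q : R -> R) :
  continuous q -> (forall t, 0 <= q t) -> (forall t : R, is_derive t 1 F (q t)) ->
  ((\int[lebesgue_measure]_(t in `[0%R, 1%R]) (Num.sqrt (q t))%:E) ^+ 2 <=
    (F 1 - F 0)%:E)%E.
Proof.
move=> qc q0 Fq; set L := (X in (X ^+ 2 <= _)%E); pose I := F 1 - F 0.
(* Stated for general [G] and [g]: it serves both for [q] and for its AM-GM majorant. *)
have FTC (G g : R -> R) : continuous g -> (forall t : R, is_derive t 1 G (g t)) ->
    (\int[lebesgue_measure]_(t in `[0%R, 1%R]) (g t)%:E = (G 1 - G 0)%:E)%E.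
  move=> gc Gg.
  have Gc : continuous G.
    move=> t; apply/differentiable_continuous/derivable1_diffP.
    by case: (Gg t).
  rewrite (@continuous_FTC2 R g G 0 1 ltr01) ?EFinB//.
  - exact: continuous_subspaceT.
  - split; first by move=> t _; case: (Gg t).
    + by apply: cvg_at_right_filter; exact: Gc.
    + by apply: cvg_at_left_filter; exact: Gc.
  - by move=> t _; rewrite derive1E; case: (Gg t).
have I0 : 0 <= I.
  by rewrite -lee_fin -(FTC F q)//; apply: integral_ge0 => t _; rewrite lee_fin.
have L0 : (0 <= L)%E.
  by apply: integral_ge0 => t _; rewrite lee_fin sqrtr_ge0.
have sc : continuous (fun t => Num.sqrt (q t)).
  by move=> t; apply: (continuous_comp (qc t)); exact: sqrt_continuous.
have LI : (L <= (Num.sqrt I)%:E)%E.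
  apply/lee_addgt0Pr => e e0; set a := Num.sqrt I + e.
  have sI0 := sqrtr_ge0 I.
  have a0 : 0 < a by rewrite /a ltr_wpDl.
  (* AM-GM: [2 sqrt q <= a + q / a]; the optimal [a] is [sqrt I], and adding [e]
     keeps it positive when [I = 0] *)
  pose g t := 2^-1 * a + (2 * a)^-1 * q t.
  have gc : continuous g.
    by move=> t; apply: cvgD; [exact: cvg_cst|apply: cvgMl_tmp; exact: qc].
  have Gg (t : R) : is_derive t 1 (fun t => (2^-1 * a) * t + (2 * a)^-1 * F t) (g t).
    have Fqt := Fq t.
    have aF := is_deriveD (is_deriveZ (2^-1 * a) (is_derive_id t 1))
      (is_deriveZ (2 * a)^-1 Fqt).
    apply: (is_derive_eq aF).
    by rewrite ![_ *: _]mulr1.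
  have -> : (Num.sqrt I)%:E + e%:E = a%:E by [].
  apply: (@le_trans _ _ (\int[lebesgue_measure]_(t in `[0%R, 1%R]) (g t)%:E)%E).
    apply: ge0_le_integral => //.
    + apply/measurable_EFinP; apply: measurable_funTS.
      exact: continuous_measurable_fun.
    + apply/measurable_EFinP; apply: measurable_funTS.
      exact: continuous_measurable_fun.
    + move=> t _; rewrite lee_fin /g.
      rewrite -[in leRHS](sqr_sqrtr (q0 t)); set s := Num.sqrt _.
      rewrite -subr_ge0.
      have -> : 2^-1 * a + (2 * a)^-1 * s ^+ 2 - s = (a - s) ^+ 2 / (2 * a).
        by field; rewrite gt_eqF.
      by rewrite divr_ge0 ?sqr_ge0// mulr_ge0// ltW.
  rewrite (FTC _ _ gc Gg) lee_fin.
  have -> : 2^-1 * a * 1 + (2 * a)^-1 * F 1 -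
      (2^-1 * a * 0 + (2 * a)^-1 * F 0) = (a ^+ 2 + I) / (2 * a).
    by rewrite /I; field; rewrite gt_eqF.
  (* The bound [(a ^+ 2 + I) / (2 * a) <= a] amounts to [I <= a ^+ 2], which holds because [a]
     exceeds [Num.sqrt I]. *)
  rewrite ler_pdivrMr ?mulr_gt0//.
  have : I <= a ^+ 2.
    by rewrite -[leLHS](sqr_sqrtr I0) ler_sqr ?nnegrE ?(ltW a0)// lerDl ltW.
  by lra.
rewrite -/I -(sqr_sqrtr I0) EFin_expe !expe2.
exact: lee_pmul.
Qed.

Lemma dot_le_sqrt (R : realType) (d : nat) (u v : 'rV[R]_d) :
  dot u v <= Num.sqrt (dot u u) * Num.sqrt (dot v v).
Proof.
have dot_ge0 (w : 'rV[R]_d) : 0 <= dot w w.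
  by apply: sumr_ge0 => i _; rewrite -expr2 sqr_ge0.
have dot_null (w z : 'rV[R]_d) : dot w w = 0 -> dot w z = 0.
  move=> /eqP; rewrite psumr_eq0; last by move=> i _; rewrite -expr2 sqr_ge0.
  move=> /allP w0; apply: big1 => i _.
  have := w0 i (mem_index_enum i); rewrite /= mulf_eq0 orbb => /eqP ->.
  by rewrite mul0r.
have dotC (w z : 'rV[R]_d) : dot w z = dot z w.
  by apply: eq_bigr => i _; rewrite mulrC.
(* Null vectors are treated apart because the main case divides by [a * b]. *)
have [u0|u0] := eqVneq (dot u u) 0; first by rewrite dot_null// u0 sqrtr0 mul0r.
have [v0|v0] := eqVneq (dot v v) 0.
  by rewrite dotC dot_null// v0 sqrtr0 mulr0.
set a := Num.sqrt (dot u u); set b := Num.sqrt (dot v v).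
have a0 : 0 < a by rewrite sqrtr_gt0 lt_def u0 dot_ge0.
have b0 : 0 < b by rewrite sqrtr_gt0 lt_def v0 dot_ge0.
(* As [dot u u = a ^+ 2] and [dot v v = b ^+ 2], this square equals
   [2 * a * b * (a * b - dot u v)]. *)
have := dot_ge0 (b *: u - a *: v).
have -> : dot (b *: u - a *: v) (b *: u - a *: v) =
    b ^+ 2 * dot u u + a ^+ 2 * dot v v - 2 * a * b * dot u v.
  rewrite /dot !mulr_sumr -big_split -sumrB; apply: eq_bigr => i _.
  by rewrite !mxE /=; ring.
rewrite -(sqr_sqrtr (dot_ge0 u)) -(sqr_sqrtr (dot_ge0 v)) -/a -/b => ab.
rewrite -subr_ge0 -(pmulr_rge0 _ (mulr_gt0 a0 b0)).
by lra.
Qed.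

Lemma is_derive_affine (R : realType) (V : normedModType R) (x v : V) (t : R) :
  is_derive t 1 (fun s => s *: v + x) v.
Proof. exact: (is_derive_line (is_derive_id (t *: v + x) v)). Qed.

Lemma derive1_affine (R : realType) (V : normedModType R) (x v : V) :
  derive1 (fun t : R => t *: v + x) = cst v.
Proof.
by apply/funext => t; rewrite derive1E; case: (is_derive_affine x v t).
Qed.

Lemma piecewise_C1_affine (R : realType) (d : nat) (x v : 'rV[R]_d) :
  piecewise_C1 (fun t => t *: v + x).
Proof.
(* A single piece, with breakpoints 0 and 1. *)
exists 1%N, (fun n => n%:R); split=> // -[|//] _; split; first exact: ltr01.
exists (fun t => t *: v + x) => //; split.
  by move=> t; case: (is_derive_affine x v t).
by rewrite derive1_affine; exact: cst_continuous.
Qed.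

Theorem lemma5p1 (R : realType) (d : nat)
    (mu nu : probability (borel_rV R d) R) (Phi : 'rV[R]_d -> R)
    (hmu : has_density mu) (hnu : has_density nu)
    (Phi_convex : convex_function setT Phi)
    (Phi_smooth : smooth Phi)
    (Phi_posdef : forall x, posdefmx (hessian Phi x))
    (Phi_opt : optimal_transport_map mu nu (gradient Phi)) :
  forall x y : 'rV[R]_d,
    (riemannian_dist (hessian Phi) x y ^+ 2 <=
       (dot (gradient Phi y - gradient Phi x) (y - x))%:E)%E /\
    dot (gradient Phi y - gradient Phi x) (y - x) <=
      euclidean_dist x y * euclidean_dist (gradient Phi x) (gradient Phi y).
Proof.
move=> x y; split; last by rewrite mulrC; exact: dot_le_sqrt.
pose v := y - x.
(* The double sum has the shape that [is_derive_partials] produces for the derivative of [F]; [qE]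
   identifies it with the quadratic form of the metric. *)
pose q t : R := \sum_j v 0 j *
  \sum_i v 0 i * partial i (partial j Phi) (t *: v + x).
pose F t : R := \sum_j v 0 j * partial j Phi (t *: v + x).
have lc : continuous (fun t : R => t *: v + x).
  by move=> t; apply: cvgD; [exact: cvgZr_tmp|exact: cvg_cst].
have qE t : q t = (v *m hessian Phi (t *: v + x) *m v^T) 0 0.
  rewrite mxE; apply: eq_bigr => j _; rewrite !mxE mulrC; congr (_ * _).
  by apply: eq_bigr => i _; rewrite !mxE.
have qc : continuous q.
  move=> t; apply: cvg_big => //= [|j _]; first exact: add_continuous.
  apply: cvgMl_tmp; apply: cvg_big => //= [|i _]; first exact: add_continuous.
  apply: cvgMl_tmp; apply: (continuous_comp (lc t)).
  by have [+ _] := Phi_smooth [:: i; j]; apply.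
have q0 t : 0 <= q t.
  (* [posdefmx] speaks of nonzero vectors only, so the case [x = y] is separate. *)
  rewrite qE; have [->|v0] := eqVneq v 0; first by rewrite !mul0mx mxE.
  by have [_ /(_ v v0)/ltW] := Phi_posdef (t *: v + x).
have Fq (t : R) : is_derive t 1 F (q t).
  rewrite /F (_ : (fun t => _) =
     \sum_j (fun t => v 0 j * partial j Phi (t *: v + x))); last first.
    by apply/funext => s; rewrite fct_sumE.
  apply: is_derive_sum => j; apply: is_deriveZ; apply: is_derive_line.
  apply: (@is_derive_partials _ _ (partial j Phi)
    (fun i => partial i (partial j Phi))) => [i z|i].
    by have [_ h] := Phi_smooth [:: j]; apply: DeriveDef => //; exact: h.
  by have [+ _] := Phi_smooth [:: i; j]; apply.
have F10 : dot (gradient Phi y - gradient Phi x) (y - x) = F 1 - F 0.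
  rewrite /F scale1r scale0r add0r subrK -sumrB; apply: eq_bigr => j _.
  by rewrite !mxE -/v mulrC mulrBr.
(* Nonnegativity is what lets the bound on the distance be squared with [lee_pmul]. *)
have dist_ge0 : (0 <= riemannian_dist (hessian Phi) x y)%E.
  apply/ereal_infP => _ [c _ <-]; apply: integral_ge0 => t _.
  by rewrite lee_fin sqrtr_ge0.
rewrite F10; apply: le_trans (sqr_integral_sqrt_le qc q0 Fq).
suff le_dist : (riemannian_dist (hessian Phi) x y <=
    \int[lebesgue_measure]_(t in `[0%R, 1%R]) (Num.sqrt (q t))%:E)%E.
  by rewrite !expe2; exact: lee_pmul.
apply: ereal_inf_lbound; exists (fun t => t *: v + x).
  split; first exact: piecewise_C1_affine.
    by rewrite scale0r add0r.
  by rewrite scale1r subrK.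
by apply: eq_integral => t _; rewrite qE /tangent_norm derive1_affine.
Qed.
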